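(* Let $q=2^h>2$, let $\Sigma_\infty$ be a hyperplane of $\mathrm{PG}(4,q)$, and let $\mathcal{C}$ be a set of $q^2$ affine points ($\mathcal{C}$-points) together with a set of planes ($\mathcal{C}$-planes) satisfying (A1)–(A4). Let $t_N,t_\infty$ be the two disjoint lines of $\Sigma_\infty$ whose union is the set of plus-points. Then there exist homogeneous coordinates $(x_0,\dots,x_4)$ of $\mathrm{PG}(4,q)$ in which $\Sigma_\infty$ has equation $x_4=0$, and an integer $n$ with $\gcd(n,h)=1$, such that $t_N=\langle(0,0,1,0,0),(0,0,0,1,0)\rangle$, $t_\infty=\langle(1,0,0,0,0),(0,1,0,0,0)\rangle$, and the $q+1$ $\mathcal{C}$-lines are $m_t=\langle(t^{2^n},1,0,0,0),(0,0,t,1,0)\rangle$ for $t\in\mathrm{GF}(q)$, together with $m_\infty=\langle(1,0,0,0,0),(0,0,1,0,0)\rangle$.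
   Context: Affine points are points of $\mathrm{PG}(4,q)\setminus\Sigma_\infty$. Conditions: (A1) each $\mathcal{C}$-plane meets $\mathcal{C}$ in a $q$-arc (q points, no three collinear); (A2) any two distinct $\mathcal{C}$-points lie in a unique $\mathcal{C}$-plane; (A3) every affine point not in $\mathcal{C}$ lies on exactly one $\mathcal{C}$-plane; (A4) every plane meeting $\mathcal{C}$ in at least three points either meets $\mathcal{C}$ in exactly four points or is a $\mathcal{C}$-plane. Under these conditions the $\mathcal{C}$-points and $\mathcal{C}$-planes (incidence by containment) form an affine plane $\mathcal{A}$ of order $q$; all $\mathcal{C}$-planes of a parallel class of $\mathcal{A}$ meet $\Sigma_\infty$ in a common line, called a $\mathcal{C}$-line. For a $\mathcal{C}$-plane $\alpha$, the $q$-arc $\alpha\cap\mathcal{C}$ lies in a unique hyperoval $\mathcal{Q}^+$ of $\alpha$, and the two points of $\mathcal{Q}^+\setminus(\alpha\cap\mathcal{C})$ are the plus-points of $\alpha$; the set of all plus-points is the union of two disjoint lines of $\Sigma_\infty$. *)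

(* Defs.v *)
From HB Require Import structures.
From mathcomp Require Import all_boot all_order all_algebra.
From mathcomp Require Import finmap.

Set Implicit Arguments.
Unset Strict Implicit.
Unset Printing Implicit Defensive.

Import GRing.Theory.
Local Open Scope ring_scope.
Local Open Scope fset_scope.

(* Subspaces of PG(4,q), q = #|F|: linear subspaces of F^5. The projective
   dimension is one less than \dim, and incidence is inclusion (_ <= _)%VS. *)
Definition PG4 (F : finFieldType) := {vspace 'rV[F]_5}.

Definition is_point (F : finFieldType) (U : PG4 F) : Prop := \dim U = 1%N.
Definition is_line (F : finFieldType) (U : PG4 F) : Prop := \dim U = 2%N.
Definition is_plane (F : finFieldType) (U : PG4 F) : Prop := \dim U = 3%N.
Definition is_hyperplane (F : finFieldType) (U : PG4 F) : Prop := \dim U = 4%N.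

Definition is_affine_point (F : finFieldType) (Sigma P : PG4 F) : Prop :=
  is_point P /\ ~~ (P <= Sigma)%VS.

Definition sect (F : finFieldType) (C : {fset {vspace 'rV[F]_5}}) (U : PG4 F) :
  {fset {vspace 'rV[F]_5}} := [fset P in C | (P <= U)%VS].

Definition no_three_collinear (F : finFieldType)
    (A : {fset {vspace 'rV[F]_5}}) : Prop :=
  forall P Q R : PG4 F, P \in A -> Q \in A -> R \in A ->
    P != Q -> P != R -> Q != R ->
    ~ exists l : PG4 F,
        is_line l /\ [/\ (P <= l)%VS, (Q <= l)%VS & (R <= l)%VS].

Definition is_arc (F : finFieldType) (k : nat) (alpha : PG4 F)
    (A : {fset {vspace 'rV[F]_5}}) : Prop :=
  [/\ forall P : PG4 F, P \in A -> is_point P /\ (P <= alpha)%VS,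
      #|` A | = k
    & no_three_collinear A].

Definition is_hyperoval (F : finFieldType) (alpha : PG4 F)
    (A : {fset {vspace 'rV[F]_5}}) : Prop :=
  is_arc (#|F| + 2)%N alpha A.

Definition condA1 (F : finFieldType)
    (C Cplanes : {fset {vspace 'rV[F]_5}}) : Prop :=
  forall alpha : PG4 F, alpha \in Cplanes -> is_arc #|F| alpha (sect C alpha).

Definition condA2 (F : finFieldType)
    (C Cplanes : {fset {vspace 'rV[F]_5}}) : Prop :=
  forall P Q : PG4 F, P \in C -> Q \in C -> P != Q ->
    exists! alpha : PG4 F,
      [/\ alpha \in Cplanes, (P <= alpha)%VS & (Q <= alpha)%VS].

Definition condA3 (F : finFieldType) (Sigma : PG4 F)
    (C Cplanes : {fset {vspace 'rV[F]_5}}) : Prop :=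
  forall P : PG4 F, is_affine_point Sigma P -> P \notin C ->
    exists! alpha : PG4 F, alpha \in Cplanes /\ (P <= alpha)%VS.

Definition condA4 (F : finFieldType)
    (C Cplanes : {fset {vspace 'rV[F]_5}}) : Prop :=
  forall pi : PG4 F, is_plane pi -> (3 <= #|` sect C pi|)%N ->
    #|` sect C pi| = 4%N \/ pi \in Cplanes.

(* Parallelism in the affine plane of C-points and C-planes. *)
Definition Cparallel (F : finFieldType) (C : {fset {vspace 'rV[F]_5}})
    (alpha beta : PG4 F) : Prop :=
  alpha = beta \/
  ~ exists P : PG4 F, [/\ P \in C, (P <= alpha)%VS & (P <= beta)%VS].

Definition is_Cline (F : finFieldType) (Sigma : PG4 F)
    (C Cplanes : {fset {vspace 'rV[F]_5}}) (l : PG4 F) : Prop :=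
  is_line l /\
  exists2 alpha : PG4 F, alpha \in Cplanes &
    forall beta : PG4 F, beta \in Cplanes -> Cparallel C alpha beta ->
      (beta :&: Sigma)%VS = l.

(* The hyperoval through a q-arc is unique for q > 2 even, so quantifying it
   existentially is the same as taking the hyperoval. *)
Definition is_plus_point (F : finFieldType)
    (C Cplanes : {fset {vspace 'rV[F]_5}}) (P : PG4 F) : Prop :=
  exists alpha : PG4 F, exists Q : {fset {vspace 'rV[F]_5}},
    [/\ alpha \in Cplanes, is_hyperoval alpha Q,
        sect C alpha `<=` Q & P \in Q `\` sect C alpha].

Definition vec (F : finFieldType) (e : 5.-tuple 'rV[F]_5)
    (a0 a1 a2 a3 a4 : F) : 'rV[F]_5 :=
  \sum_(i < 5) [:: a0; a1; a2; a3; a4]`_i *: tnth e i.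

Definition join2 (F : finFieldType) (u v : 'rV[F]_5) : PG4 F :=
  <<[:: u; v]>>%VS.

Definition m_line (F : finFieldType) (e : 5.-tuple 'rV[F]_5) (n : nat)
    (t : F) : PG4 F :=
  join2 (vec e (t ^+ (2 ^ n)%N) 1 0 0 0) (vec e 0 0 t 1 0).

Definition m_infty (F : finFieldType) (e : 5.-tuple 'rV[F]_5) : PG4 F :=
  join2 (vec e 1 0 0 0 0) (vec e 0 0 1 0 0).

(* Main.v *)
(* Normalise a linear form phi with kernel Sigma to the value 1 on vectors of
   affine points. In characteristic 2, (A2)-(A4) force the fourth point of the
   plane through three C-points P, Q, R in no common C-plane to be P + Q + R:
   otherwise a line PS would meet a line QR in an affine point outside C on two
   C-planes. Hence the set of C-points is a coset of an additive group G of
   order q^2 in Sigma. In each C-plane exactly two points at infinity are not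
   spanned by elements of G; they are its plus-points. So G meets tN and
   tinfty trivially and is the graph of an additive bijection g from tN to
   tinfty, and the C-line of a C-plane is <x, g x> for some x in tN. As g maps
   points to points it is semilinear; its field automorphism is a power 2^n of
   Frobenius, and it fixes only 0 and 1 because no two elements of G are
   proportional, so gcd(n,h) = 1. *)
Require Import Defs.
From HB Require Import structures.
From mathcomp Require Import all_boot all_order all_algebra all_fingroup all_solvable all_field.
From mathcomp Require Import finmap.

Set Implicit Arguments.
Unset Strict Implicit.
Unset Printing Implicit Defensive.

Import GRing.Theory FinRing.Theory.
Local Open Scope fset_scope.
Local Open Scope ring_scope.

(** * Generators, endomorphisms and subfields of finite fields of even order *)

Lemma finField_cyclic (F : finFieldType) :
  exists z : F, #|F|.-1.-primitive_root z /\
    forall x, x != 0 -> exists k, x = z ^+ k.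
Proof.
have /cyclicP[u Eu] := field_unit_group_cyclic [set: {unit F}]%G.
exists (val u); split=> [|x x0]; last first.
  have : finField_unit x0 \in <[u]>%g by rewrite -Eu inE.
  by case/cycleP=> k Ek; exists k; rewrite -val_unitX -Ek.
have o_u : #[u]%g = #|F|.-1 by rewrite -card_finField_unit /order -Eu.
rewrite -o_u; apply/andP; split; first exact: order_gt0.
apply/forallP=> i; rewrite unity_rootE -val_unitX -val_unit1 val_eqE.
rewrite -order_dvdn; apply/eqP; apply/idP/idP=> [|/eqP-> //].
by move/(dvdn_leq (ltn0Sn i)) => le; rewrite eqn_leq le (ltn_ord i).
Qed.

(* The product of the X - z^(2^i), z a generator, has its coefficients in the
   prime field, so an endomorphism maps z to one of its roots. *)
Lemma finField_char2_endo (h : nat) (F : finFieldType)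
    (cardF : #|F| = (2 ^ h)%N) (a : {rmorphism F -> F}) :
  exists n, forall t, a t = t ^+ (2 ^ n).
Proof.
have char2 : 2 \in [pchar F] by apply: card_finPcharP cardF _.
have h_gt0 : (0 < h)%N by have := finNzRing_gt1 F; rewrite cardF; case: (h).
have [z [_ gen_z]] := finField_cyclic F.
pose p := \prod_(i < h) ('X - (z ^+ (2 ^ i))%:P).
have pE : map_poly (pFrobenius_aut char2) p = p.
  rewrite /p rmorph_prod /= (eq_bigr (fun i : 'I_h => 'X - (z ^+ (2 ^ i.+1))%:P)); last first.
    move=> i _; rewrite rmorphB /= map_polyX map_polyC /=.
    by rewrite pFrobenius_autE -exprM -expnSr.
  (* Squaring shifts the factors cyclically: the last one becomes the first because
     [z ^+ (2 ^ h) = z]. *)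
  move: h_gt0 cardF; case: {p} h => // k _ cardF.
  rewrite big_ord_recr big_ord_recl /= mulrC -cardF expf_card expn0 expr1.
  by congr (_ * _); apply: eq_bigr.
have pa : map_poly a p = p.
  apply/polyP=> i; rewrite coef_map /=.
  have /polyP/(_ i) := pE; rewrite coef_map /= pFrobenius_autE => /eqP.
  rewrite -subr_eq0 expr2 -[X in _ - X]mulr1 -mulrBr mulf_eq0 subr_eq0.
  by case/orP=> /eqP->; rewrite ?rmorph0 ?rmorph1.
have : root p (a z).
  rewrite -pa fmorph_root rootE horner_prod (bigD1 (Ordinal h_gt0)) //=.
  by rewrite hornerXsubC expn0 expr1 subrr mul0r.
rewrite rootE horner_prod prodf_seq_eq0 => /hasP[i _] /=.
rewrite hornerXsubC subr_eq0 => /eqP az; exists i => t.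
have [->|/gen_z[k ->]] := eqVneq t 0.
  by rewrite rmorph0 expr0n expn_eq0.
by rewrite rmorphXn /= az -!exprM mulnC.
Qed.

(** If [d], the gcd of [n] and [h], exceeds 1, the subfield of order [2 ^ d] is fixed and larger
    than {0, 1}. Its multiplicative group is generated by [z ^+ m], where [m] is the quotient of
    [q - 1] by [2 ^ d - 1]; this element is nonzero, and it is not 1 because [m < q - 1]. *)
Lemma coprime_of_fixed (h n : nat) (F : finFieldType)
    (cardF : #|F| = (2 ^ h)%N) :
  (forall c : F, c ^+ (2 ^ n) = c -> c = 0 \/ c = 1) -> coprime n h.
Proof.
move=> fixn.
have h_gt0 : (0 < h)%N by have := finNzRing_gt1 F; rewrite cardF; case: (h).
have [z [prim_z _]] := finField_cyclic F.
rewrite /coprime; set d := gcdn n h.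
have d_gt0 : (0 < d)%N by rewrite gcdn_gt0 h_gt0 orbT.
have [//|d1] := eqVneq d 1%N; exfalso.
have dh : ((2 ^ d).-1 %| #|F|.-1)%N.
  by rewrite cardF -(divnK (dvdn_gcdr n h)) mulnC expnM dvdn_pred_predX.
have d2 : (1 < (2 ^ d).-1)%N.
  case: d d1 d_gt0 {dh} => [|[|k]] // _ _.
  by rewrite -ltnS prednK ?expn_gt0 // (@leq_trans (2 ^ 2)) // leq_exp2l.
have F_gt0 : (0 < #|F|.-1)%N by have := finNzRing_gt1 F; case: #|F| => [|[]].
pose m := (#|F|.-1 %/ (2 ^ d).-1)%N.
have cd : (z ^+ m) ^+ (2 ^ d) = z ^+ m.
  have c1 : (z ^+ m) ^+ (2 ^ d).-1 = 1.
    by rewrite -exprM divnK // prim_expr_order.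
  by rewrite -(@prednK (2 ^ d)) ?expn_gt0 // exprS c1 mulr1.
have cdk k : (z ^+ m) ^+ (2 ^ (d * k)) = z ^+ m.
  by elim: k => [|k IH]; rewrite ?muln0 // mulnS expnD exprM cd IH.
have := fixn (z ^+ m); rewrite -{1}(divnK (dvdn_gcdl n h)) mulnC cdk.
case=> // /eqP.
  by rewrite expf_eq0 (prim_root_eq0 prim_z) -(ltn_predK F_gt0) andbF.
rewrite -(prim_order_dvd prim_z) => /dvdn_leq.
rewrite divn_gt0 ?(ltnW d2) // dvdn_leq // => /(_ isT).
by rewrite leqNgt ltn_Pdiv.
Qed.

(** * Small spans, and hyperplanes as kernels of linear forms *)

Section Spans.
Variables (F : fieldType) (vT : vectType F).
Implicit Types u v w : vT.

Lemma span2P u v w :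
  reflect (exists x y, w = x *: u + y *: v) (w \in <<[:: u; v]>>%VS).
Proof.
rewrite span_cons span_seq1; apply: (iffP memv_addP) => [[a /vlineP[x ->]]|].
  by case=> _ /vlineP[y ->] ->; exists x, y.
by case=> x [y ->]; exists (x *: u); rewrite ?memvZ ?memv_line //;
  exists (y *: v); rewrite ?memvZ ?memv_line.
Qed.

Lemma span3P u v w t :
  reflect (exists x y z, t = x *: u + y *: v + z *: w)
          (t \in <<[:: u; v; w]>>%VS).
Proof.
rewrite span_cons; apply: (iffP memv_addP) => [[a /vlineP[x ->]]|].
  by case=> _ /span2P[y [z ->]] ->; exists x, y, z; rewrite addrA.
case=> x [y [z ->]]; exists (x *: u); first by rewrite ?memvZ ?memv_line.
exists (y *: v + z *: w); rewrite ?addrA //.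
by apply/span2P; exists y, z.
Qed.

Lemma dim_span2 u v : v != 0 -> u \notin <[v]>%VS -> \dim <<[:: u; v]>> = 2.
Proof.
move=> v0 uv; have : free [:: u; v] by rewrite free_cons span_seq1 uv seq1_free.
by rewrite /free => /eqP.
Qed.

(** The form is the coordinate along [o] in the basis made of [o] and a basis of [S]. *)
Lemma hyperplane_form (S : {vspace vT}) (o : vT) :
  o \notin S -> (\dim S).+1 = \dim {:vT} ->
  exists phi : {scalar vT}, forall v, (v \in S) = (phi v == 0).
Proof.
move=> oS dS; pose X := [tuple of o :: vbasis S].
have frX : free X.
  by rewrite free_cons (span_basis (vbasisP S)) oS (basis_free (vbasisP S)).
have X_basis : basis_of fullv X.
  by rewrite basisEfree frX subvf /= -dS size_tuple.
exists (coord X 0 : {scalar vT}) => v /=.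
have vX : v \in <<X>>%VS by rewrite (span_basis X_basis) memvf.
apply/idP/eqP => [vS|v0].
  have -> : v = \sum_i coord (vbasis S) i v *: X`_(lift 0 i).
    exact: coord_vbasis.
  rewrite linear_sum /= big1 // => i _.
  by rewrite linearZ /= (coord_free (lift 0 i) 0 frX) mulr0.
rewrite (coord_span vX) big_ord_recl /= v0 scale0r add0r.
apply: rpred_sum => i _; rewrite rpredZ //.
by apply/vbasis_mem/mem_nth; rewrite size_tuple ltn_ord.
Qed.

End Spans.

(** * Affine points as normalised vectors *)

Section CArc.
Variables (h : nat) (F : finFieldType).
Hypothesis cardF : #|F| = (2 ^ h)%N.
Hypothesis q_gt2 : (2 < #|F|)%N.
Local Notation V := 'rV[F]_5.
Variables (Sigma : PG4 F) (phi : {scalar V}).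
Hypothesis hSigma : is_hyperplane Sigma.
Hypothesis phiP : forall v, (v \in Sigma) = (phi v == 0).
Variables (C Cplanes : {fset {vspace V}}).
Hypothesis hC : forall P : PG4 F, P \in C -> is_affine_point Sigma P.
Hypothesis cardC : #|` C | = (#|F| ^ 2)%N.
Hypothesis hCplanes : forall alpha : PG4 F, alpha \in Cplanes -> is_plane alpha.
Hypothesis hA1 : condA1 C Cplanes.
Hypothesis hA2 : condA2 C Cplanes.
Hypothesis hA3 : condA3 Sigma C Cplanes.
Hypothesis hA4 : condA4 C Cplanes.

Let char2 : 2 \in [pchar F] := card_finPcharP cardF isT.

Let addvv (v : V) : v + v = 0.
Proof. by rewrite -[v]scale1r -scalerDl -mulr2n (pcharf0 char2) scale0r. Qed.

Let oppv (v : V) : - v = v.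
Proof. by apply/esym/eqP; rewrite -addr_eq0 addvv. Qed.

Let addKv (v w : V) : v + (v + w) = w.
Proof. by rewrite addrA addvv add0r. Qed.

Let phiZ c v : phi (c *: v) = c * phi v. Proof. exact: linearZ. Qed.
Let phiD v w : phi (v + w) = phi v + phi w. Proof. exact: linearD. Qed.

(* An affine point is represented by its only vector on which [phi] is 1. *)
Definition Cvec : pred V := [pred v | (phi v == 1) && (<[v]>%VS \in C)].
Local Notation K := Cvec.

Lemma phi_Cvec v : K v -> phi v = 1. Proof. by case/andP=> /eqP. Qed.

Lemma Cvec_C v : K v -> <[v]>%VS \in C. Proof. by case/andP. Qed.

Lemma affine_neq0 v : phi v = 1 -> v != 0.
Proof. by move=> v1; apply: contra_eq_neq v1 => ->; rewrite linear0 eq_sym oner_eq0. Qed.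

Lemma affine_vline v w : phi v = 1 -> phi w = 1 -> w \in <[v]>%VS -> w = v.
Proof.
move=> v1 w1 /vlineP[k Ew]; move: w1; rewrite Ew phiZ v1 mulr1 => ->.
by rewrite scale1r.
Qed.

Lemma affine_vline_inj v w : phi v = 1 -> phi w = 1 -> <[v]>%VS = <[w]>%VS -> v = w.
Proof. by move=> v1 w1 E; apply: affine_vline => //; rewrite -E memv_line. Qed.

Lemma vline_neq v w : K v -> K w -> v != w -> (<[v]> != <[w]>)%VS.
Proof.
by move=> /phi_Cvec v1 /phi_Cvec w1; apply: contra_neq; apply: affine_vline_inj.
Qed.

Lemma affine_pointP v : phi v = 1 -> is_affine_point Sigma <[v]>%VS.
Proof.
move=> v1; split; first by rewrite /is_point dim_vline affine_neq0.
by rewrite -memvE phiP v1 oner_eq0.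
Qed.

Lemma C_Cvec P : P \in C -> exists2 v, K v & P = <[v]>%VS.
Proof.
move=> PC; have [P1 PS] := hC PC.
move: (memv_pick P); set p := vpick P => pP.
have p0 : p != 0 by rewrite vpick0 -dimv_eq0 P1.
have EP : P = <[p]>%VS.
  by apply/eqP; rewrite eq_sym eqEdim -memvE pP dim_vline p0 P1.
have fp : phi p != 0 by rewrite -phiP memvE -EP.
have E2 : P = <[(phi p)^-1 *: p]>%VS.
  rewrite EP; apply/eqP; rewrite eqEsubv -!memvE.
  rewrite [X in _ && X]memvZ ?memv_line // andbT.
  by apply/vlineP; exists (phi p); rewrite scalerA divff // scale1r.
exists ((phi p)^-1 *: p) => //.
by rewrite /K /= -E2 PC phiZ mulVf // eqxx.
Qed.

Lemma sectE alpha v : K v -> (<[v]>%VS \in sect C alpha) = (v \in alpha).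
Proof. by move=> /Cvec_C Kv; rewrite !inE /= Kv memvE. Qed.

Lemma Cplane_through a b : K a -> K b -> a != b ->
  exists2 alpha, alpha \in Cplanes & a \in alpha /\ b \in alpha.
Proof.
move=> Ka Kb ab; have [alpha [[Ha Aa Ab] _]] :=
  hA2 (Cvec_C Ka) (Cvec_C Kb) (vline_neq Ka Kb ab).
by exists alpha; rewrite // !memvE.
Qed.

Lemma Cplane_uniq1 alpha beta v : alpha \in Cplanes -> beta \in Cplanes ->
  phi v = 1 -> ~~ K v -> v \in alpha -> v \in beta -> alpha = beta.
Proof.
move=> Ha Hb v1; rewrite /K /= v1 eqxx /= => Kv va vb.
have [g [_ gU]] := hA3 (affine_pointP v1) Kv.
by apply: etrans (esym (gU alpha _)) (gU beta _); split; rewrite // -memvE.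
Qed.

(** If one of the two points is outside [C], (A3) at that point suffices; otherwise (A2) applies. *)
Lemma Cplane_uniq alpha beta v w : alpha \in Cplanes -> beta \in Cplanes ->
  phi v = 1 -> phi w = 1 -> v != w ->
  v \in alpha -> w \in alpha -> v \in beta -> w \in beta -> alpha = beta.
Proof.
move=> Ha Hb v1 w1 vw va wa vb wb.
have [Kv|Kv] := boolP (K v); last exact: (Cplane_uniq1 Ha Hb v1).
have [Kw|Kw] := boolP (K w); last exact: (Cplane_uniq1 Ha Hb w1).
have [g [_ gU]] := hA2 (Cvec_C Kv) (Cvec_C Kw) (vline_neq Kv Kw vw).
by apply: etrans (esym (gU alpha _)) (gU beta _); split; rewrite // -memvE.
Qed.

(** * Closure of the C-vectors under sums of three *)

Lemma mem_span2 (U : {vspace V}) a b v :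
  a \in U -> b \in U -> v \in <<[:: a; b]>>%VS -> v \in U.
Proof. by move=> aU bU /span2P[x [y ->]]; rewrite memvD ?memvZ. Qed.

(** By (A2) the line joining two C-points lies in a C-plane, where a third C-point on it would
    contradict (A1). *)
Lemma Cvec_cap a b c : K a -> K b -> K c -> a != b -> a != c -> b != c ->
  c \notin <<[:: a; b]>>%VS.
Proof.
move=> Ka Kb Kc ab ac bc; apply/negP => cab.
have [alpha Ha [aa ba]] := Cplane_through Ka Kb ab.
have [_ _ n3] := hA1 Ha.
apply: (n3 <[a]> <[b]> <[c]>)%VS; rewrite ?sectE ?vline_neq //.
  exact: mem_span2 cab.
exists <<[:: a; b]>>%VS; rewrite -!memvE cab !memv_span ?inE ?eqxx ?orbT //.
split=> //; apply: dim_span2; first exact/affine_neq0/phi_Cvec.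
by apply: contra_neqN ab; apply: affine_vline; apply: phi_Cvec.
Qed.

(** If [x] is not 1, then [y + z] is nonzero and the lines [QR] and [Ps] meet in an affine point
    [X]. It is outside [C] by the cap property, so (A3) identifies the C-planes through these two
    lines, against the hypothesis on [P], [Q], [R]. The other two coefficients follow by permuting
    the three points. *)
Lemma fourth_coef P Q R s x y z : K P -> K Q -> K R -> K s ->
  P != Q -> P != R -> Q != R -> s != P -> s != Q -> s != R ->
  (forall alpha, alpha \in Cplanes -> ~ [/\ P \in alpha, Q \in alpha & R \in alpha]) ->
  s = x *: P + (y *: Q + z *: R) -> x = 1.
Proof.
move=> KP KQ KR Ks PQ PR QR sP sQ sR non Es.
have [P1 Q1 R1 s1] : [/\ phi P = 1, phi Q = 1, phi R = 1 & phi s = 1].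
  by split; apply: phi_Cvec.
have : phi s = x + (y + z) by rewrite Es !phiD !phiZ P1 Q1 R1 !mulr1.
rewrite s1; set c := y + z => Ec.
have [c0|c0] := eqVneq c 0; first by rewrite Ec c0 addr0.
(* If [y] or [z] vanished, [s] would be a third C-point on a line through [P]. Both being nonzero
   makes [X] differ from [Q] and [R]. *)
have y0 : y != 0.
  apply/negP => /eqP y0; have := Cvec_cap KP KR Ks PR; rewrite ![_ == s]eq_sym.
  move=> /(_ sP sR)/negP[]; apply/span2P; exists x, z.
  by rewrite Es y0 scale0r add0r.
have z0 : z != 0.
  apply/negP => /eqP z0; have := Cvec_cap KP KQ Ks PQ; rewrite ![_ == s]eq_sym.
  move=> /(_ sP sQ)/negP[]; apply/span2P; exists x, y.
  by rewrite Es z0 scale0r addr0.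
pose X := c^-1 *: (y *: Q + z *: R).
have X1 : phi X = 1 by rewrite phiZ phiD !phiZ Q1 R1 !mulr1 mulVf.
have cX : c *: X = y *: Q + z *: R by rewrite scalerA mulfV // scale1r.
have QX : Q != X.
  apply: contra_neq QR => QX; move: cX; rewrite -QX scalerDl => /addrI.
  by apply: scalerI.
have RX : R != X.
  apply: contra_neq QR => RX; move: cX; rewrite -RX scalerDl => /addIr.
  by move/(scalerI y0).
have Xspan : X \in <<[:: Q; R]>>%VS.
  by apply/span2P; exists (c^-1 * y), (c^-1 * z); rewrite /X scalerDr !scalerA.
have KX : ~~ K X by apply: contraL Xspan => KX; apply: Cvec_cap.
have [alpha Ha [aQ aR]] := Cplane_through KQ KR QR.
have [beta Hb [bs bP]] := Cplane_through Ks KP sP.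
(* In characteristic 2, [s + x *: P] equals [y *: Q + z *: R], so [X] is also on the line through
   [s] and [P]. *)
have EX : X = c^-1 *: (s + x *: P).
  by rewrite Es addrC addKv.
have Xb : X \in beta by rewrite EX memvZ // memvD // memvZ.
have Eab := Cplane_uniq1 Ha Hb X1 KX (mem_span2 aQ aR Xspan) Xb.
by case: (non alpha Ha); rewrite {1}Eab.
Qed.

(** The plane spanned by the three points is not a C-plane, so by (A4) it has exactly one further
    C-point, whose three coefficients are all 1 by [fourth_coef]. *)
Lemma Cvec_add_noncoplanar P Q R : K P -> K Q -> K R ->
  P != Q -> P != R -> Q != R ->
  (forall alpha, alpha \in Cplanes -> ~ [/\ P \in alpha, Q \in alpha & R \in alpha]) ->
  K (P + Q + R).
Proof.
move=> KP KQ KR PQ PR QR non; pose pi := <<[:: P; Q; R]>>%VS.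
have [Ppi Qpi Rpi] : [/\ P \in pi, Q \in pi & R \in pi].
  by split; rewrite memv_span // !inE eqxx ?orbT.
have pi3 : is_plane pi.
  have : free [:: P; Q; R].
    rewrite free_cons; apply/andP; split; first by apply: Cvec_cap; rewrite // eq_sym.
    rewrite free_cons span_seq1 seq1_free.
    rewrite (affine_neq0 (phi_Cvec KR)) andbT.
    by apply: contra_neqN QR; apply: affine_vline; apply: phi_Cvec.
  by move=> /eqP.
pose T := <[P]>%VS |` [fset <[Q]>%VS; <[R]>%VS].
have T3 : #|` T| = 3.
  by rewrite cardfsU1 cardfs2 in_fset2 negb_or !vline_neq.
have Tpi : T `<=` sect C pi.
  apply/fsubsetP => X; rewrite in_fset1U in_fset2.
  by case/or3P=> /eqP->; rewrite sectE.
have [|E4|pC] := hA4 pi3; first by have := fsubset_leq_card Tpi; rewrite T3.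
  have /fsubsetPn[S Spi] : ~~ (sect C pi `<=` T).
    by apply/negP => /fsubset_leq_card; rewrite E4 T3.
  have : S \in C by move: Spi; rewrite !inE => /andP[].
  case/C_Cvec=> s Ks ES; rewrite ES in_fset1U in_fset2 !negb_or => /and3P[sP sQ sR].
  have {}sP : s != P by apply: contra_neq sP => ->.
  have {}sQ : s != Q by apply: contra_neq sQ => ->.
  have {}sR : s != R by apply: contra_neq sR => ->.
  have := Spi; rewrite ES sectE // => /span3P[x [y [z Es]]].
  have x1 : x = 1.
    by apply: fourth_coef KP KQ KR Ks PQ PR QR sP sQ sR non _; rewrite Es addrA.
  have y1 : y = 1.
    rewrite eq_sym in PQ; apply: fourth_coef KQ KP KR Ks PQ QR PR sQ sP sR _ _.
      by move=> alpha Ha [? ? ?]; case: (non alpha Ha).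
    by rewrite Es -addrA addrCA.
  have z1 : z = 1.
    rewrite eq_sym in PR; rewrite eq_sym in QR.
    apply: fourth_coef KR KP KQ Ks PR QR PQ sR sP sQ _ _.
      by move=> alpha Ha [? ? ?]; case: (non alpha Ha).
    by rewrite Es addrC.
  by rewrite Es x1 y1 z1 !scale1r in Ks.
by case: (non pi pC).
Qed.

(** * Counting C-vectors *)

Lemma card_sect U : #|` sect C U| = #|[pred v | K v & v \in U]|.
Proof.
have -> : sect C U = [fset <[v]>%VS | v in [pred v | K v & v \in U]].
  apply/fsetP=> P; apply/idP/imfsetP => [PU|[v /andP[Kv vU] ->]]; last by rewrite sectE.
  move: (PU); rewrite !inE => /andP[/C_Cvec[v Kv EP] _]; exists v => //=.
  by apply/andP; rewrite -(sectE _ Kv) -EP.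
rewrite card_in_imfset /=; first by rewrite cardE.
move=> v w /andP[Kv _] /andP[Kw _]; exact: affine_vline_inj (phi_Cvec Kv) (phi_Cvec Kw).
Qed.

Lemma card_Cvec : #|K| = (#|F| ^ 2)%N.
Proof.
rewrite -cardC; transitivity #|` sect C fullv|.
  by rewrite card_sect; apply: eq_card => v; rewrite [RHS]inE memvf andbT.
by congr #|` _|; apply/fsetP => P; rewrite !inE subvf andbT.
Qed.

Lemma card_Cplane alpha : alpha \in Cplanes ->
  #|[pred v | K v & v \in alpha]| = #|F|.
Proof. by move=> Ha; rewrite -card_sect; case: (hA1 Ha). Qed.

Lemma Cplane_Cvec alpha : alpha \in Cplanes -> exists2 a, K a & a \in alpha.
Proof.
move=> Ha; have : (0 < #|[pred v | K v & v \in alpha]|)%N.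
  by rewrite card_Cplane // (ltn_trans _ q_gt2).
by case/card_gt0P=> a /andP[]; exists a.
Qed.

Lemma Cvec_outside alpha : alpha \in Cplanes -> exists2 a, K a & a \notin alpha.
Proof.
move=> Ha; have : ~~ (K \subset alpha).
  apply/negP => Ka; have := card_Cplane Ha.
  rewrite (@eq_card _ _ K) => [|v]; last first.
    by rewrite [LHS]inE; apply: andb_idr => Kv; apply: (subsetP Ka).
  move/eqP; rewrite card_Cvec -{2}(expn1 #|F|) eqn_exp2l // (ltn_trans _ q_gt2) //.
by case/subsetPn=> a Ka Na; exists a.
Qed.

(** For distinct points in one C-plane, a C-point [T] outside it reduces to the previous case twice:
    [P + Q + T] is a C-vector outside the plane, and its sum with [T] and [R] is [P + Q + R]. *)
Lemma Cvec_add P Q R : K P -> K Q -> K R -> K (P + Q + R).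
Proof.
move=> KP KQ KR.
have [<-|PQ] := eqVneq P Q; first by rewrite addvv add0r.
have [<-|PR] := eqVneq P R; first by rewrite addrAC addvv add0r.
have [<-|QR] := eqVneq Q R; first by rewrite -addrA addvv addr0.
have [P1 Q1 R1] : [/\ phi P = 1, phi Q = 1 & phi R = 1] by split; apply: phi_Cvec.
have [alpha Ha [Pa Qa]] := Cplane_through KP KQ PQ.
have uniq_a beta : beta \in Cplanes -> P \in beta -> Q \in beta -> beta = alpha.
  by move=> Hb Pb Qb; apply: Cplane_uniq P1 Q1 PQ _ _ _ _.
have [Ra|Ra] := boolP (R \in alpha); last first.
  apply: Cvec_add_noncoplanar => // beta Hb [Pb Qb Rb].
  by rewrite -(uniq_a beta) ?Rb in Ra.
have [T KT Ta] := Cvec_outside Ha.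
have neqT X : X \in alpha -> X != T by apply: contraTneq => ->.
have KU : K (P + Q + T).
  apply: Cvec_add_noncoplanar; rewrite ?neqT // => beta Hb [Pb Qb Tb].
  by rewrite -(uniq_a beta) ?Tb in Ta.
have Ua : P + Q + T \notin alpha.
  by apply: contra Ta => Ua; rewrite -(addKv (P + Q) T) memvD // memvD.
have PQRa : P + Q + R \in alpha by rewrite !memvD.
have E : P + Q + R = (P + Q + T) + T + R by rewrite -[P + Q + T + T]addrA addvv addr0.
rewrite E; apply: Cvec_add_noncoplanar => //.
- apply: contra_neq PQ => PQT; have := addKv T (P + Q).
  by rewrite [T + (P + Q)]addrC PQT addvv => /esym/eqP; rewrite addr_eq0 oppv => /eqP.
- by apply: contraNneq Ua => ->.
- by rewrite eq_sym neqT.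
move=> beta Hb [Ub Tb Rb].
have PQRb : P + Q + R \in beta by rewrite E memvD // memvD.
have ba : beta = alpha.
  (* Membership of [P + Q + R] in [C] is not known yet; uniqueness of the C-plane holds for any two
     distinct affine points. *)
  apply: (@Cplane_uniq _ _ R (P + Q + R)) => //.
    by rewrite !phiD P1 Q1 R1 -mulr2n (pcharf0 char2) add0r.
  apply: contra_neq PQ => ER; apply/eqP; rewrite -subr_eq0 oppv; apply/eqP.
  by apply: (addIr R); rewrite add0r -ER.
by rewrite ba (negPf Ta) in Tb.
Qed.

(** * The additive group of C-directions *)

Section Directions.
Variable o : V.
Hypothesis Ko : K o.

(** The group of which the C-vectors form a coset. It does not depend on [o]: its elements are the
    sums, equivalently the differences, of two C-vectors. *)
Definition Cdir : pred V := [pred g | K (o + g)].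
Local Notation G := Cdir.

Lemma CdirE g : G g = K (o + g). Proof. by []. Qed.

Lemma phi_Cdir g : G g -> phi g = 0.
Proof.
by move/phi_Cvec => /eqP; rewrite phiD (phi_Cvec Ko) -subr_eq0 addrAC subrr add0r => /eqP.
Qed.

Lemma Cdir0 : G 0. Proof. by rewrite CdirE addr0. Qed.

Lemma Cvec_Cdir a g : K a -> G g -> K (a + g).
Proof.
move=> Ka Gg; rewrite -(addKv o g) addrA; exact: Cvec_add.
Qed.

Lemma Cdir_add_Cvec a b : K a -> K b -> G (a + b).
Proof. by move=> Ka Kb; rewrite CdirE addrA Cvec_add. Qed.

Lemma CdirD f g : G f -> G g -> G (f + g).
Proof. by move=> Gf Gg; rewrite CdirE addrA Cvec_Cdir. Qed.

Lemma card_Cdir : #|G| = (#|F| ^ 2)%N.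
Proof.
rewrite -card_Cvec -(card_imset G (addrI o)); apply: eq_card => v.
apply/imsetP/idP=> [[g Gg ->] //|Kv].
by exists (o + v); rewrite ?addKv // inE /= addKv.
Qed.

(** Otherwise [o], [o + g] and [o + c *: g] would be three collinear C-points. *)
Lemma Cdir_cap g c : G g -> g != 0 -> G (c *: g) -> c = 0 \/ c = 1.
Proof.
move=> Gg g0 Gc; have [|c0] := eqVneq c 0; first by left.
have [|c1] := eqVneq c 1; first by right.
have neqo (f : V) : f != 0 -> o != o + f.
  by apply: contra_neq => E; apply: (addrI o); rewrite addr0 -E.
have /negP[] : o + c *: g \notin <<[:: o; (o + g)%R]>>%VS.
  apply: Cvec_cap => //; rewrite ?neqo // ?scaler_eq0 ?negb_or ?c0 //.
  apply: contra_neq c1 => /addrI /eqP; rewrite -subr_eq0 -{1}[g]scale1r -scalerBl.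
  by rewrite scaler_eq0 (negPf g0) orbF subr_eq0 => /eqP.
apply/span2P; exists (1 - c), c.
by rewrite scalerDr addrA -scalerDl subrK scale1r.
Qed.

(** For a C-vector [a] of the plane, [w] in [G] would make [a], [a + w] and [w] three collinear
    points of the hyperoval. *)
Lemma plus_point_notin_Cdir w : is_plus_point C Cplanes <[w]>%VS -> w != 0 -> ~~ G w.
Proof.
case=> alpha [Q [Ha [Qpt _ Q3] sQ wQ]] w0; apply/negP => Gw.
have [a Ka aa] := Cplane_Cvec Ha.
move: wQ; rewrite in_fsetD => /andP[_ wQ].
have [_ wa] := Qpt _ wQ; rewrite -memvE in wa.
have Kaw := Cvec_Cdir Ka Gw.
have aQ v : K v -> v \in alpha -> <[v]>%VS \in Q.
  by move=> Kv va; apply: (fsubsetP sQ); rewrite sectE.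
have aS v : K v -> (<[v]> != <[w]>)%VS.
  move=> Kv; apply/eqP => E; have : w \in <[v]>%VS by rewrite E memv_line.
  case/vlineP=> c Ew; have := phi_Cdir Gw; rewrite Ew phiZ (phi_Cvec Kv) mulr1 => c0.
  by rewrite Ew c0 scale0r eqxx in w0.
apply: (Q3 _ _ _ (aQ a Ka aa) (aQ _ Kaw _) wQ); rewrite ?aS ?memvD ?vline_neq //.
  by apply: contra_neq w0 => E; apply: (addrI a); rewrite addr0 -E.
exists <<[:: a; w]>>%VS; rewrite -!memvE memvD ?memv_span ?inE ?eqxx ?orbT //.
split=> //; apply: dim_span2 => //.
apply/vlineP=> -[c Ea]; have := phi_Cvec Ka; rewrite Ea phiZ phi_Cdir // mulr0.
by move/esym/eqP; rewrite oner_eq0.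
Qed.

(** * Points at infinity of a C-plane that no secant passes through *)

Lemma dim_Cplane_infty alpha : alpha \in Cplanes -> \dim (alpha :&: Sigma) = 2.
Proof.
move=> Ha; have [a Ka aa] := Cplane_Cvec Ha.
have aS : a \notin Sigma by rewrite phiP (phi_Cvec Ka) oner_eq0.
have d5 : \dim (alpha + Sigma) = 5.
  have : (\dim Sigma < \dim (alpha + Sigma))%N; last rewrite hSigma => lt4.
    rewrite ltn_neqAle dimvS ?addvSr // andbT.
    apply: contra aS => /eqP E.
    have <- : (alpha + Sigma)%VS = Sigma.
      by apply/esym/eqP; rewrite eqEdim addvSr -E leqnn.
    exact: (subvP (addvSl alpha Sigma)).
  apply/anti_leq; rewrite lt4 andbT.
  by have := dimvS (subvf (alpha + Sigma)); rewrite dimvf.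
have := dimv_sum_cap alpha Sigma; rewrite d5 hSigma (hCplanes Ha).
by rewrite -[(3 + 4)%N]/(5 + 2)%N => /addnI.
Qed.

Lemma card_Cplane_dir alpha : alpha \in Cplanes ->
  #|[pred g | G g & g \in alpha]| = #|F|.
Proof.
move=> Ha; have [a Ka aa] := Cplane_Cvec Ha.
rewrite -(card_Cplane Ha) -(card_imset [pred g | G g & g \in alpha] (addrI a)).
apply: eq_card => v; apply/imsetP/andP=> [[g /andP[Gg ga] ->]|[Kv va]].
  by split; [apply: Cvec_Cdir | apply: memvD].
exists (a + v); rewrite ?addKv // inE.
by rewrite Cdir_add_Cvec // memvD.
Qed.

(** For [w] in [Sigma] this says that [w] is nonzero and that no line joining two C-points passes
    through its point. *)
Definition missed (w : V) := forall c, c != 0 -> ~~ G (c *: w).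

(* The multiples of the q-1 nonzero vectors of G in a C-plane are at most
   (q-1)^2 of the q^2 vectors at infinity, and (q-1)^2 + q < q^2. *)
Lemma exists_missed alpha w : alpha \in Cplanes ->
  exists v, [/\ v \in (alpha :&: Sigma)%VS, missed v & v \notin <[w]>%VS].
Proof.
move=> Ha; pose H := [set g : V | G g & g \in alpha] :\ 0.
pose hit := (fun p : F * V => p.1 *: p.2) @: setX [set~ 0] H.
have cH : #|H| = #|F|.-1.
  have := cardsD1 (0 : V) [set g | G g & g \in alpha].
  by rewrite inE Cdir0 mem0v /= -/H cardsE card_Cplane_dir // => ->.
have chit : (#|hit| <= #|F|.-1 * #|F|.-1)%N.
  by apply: leq_trans (leq_imset_card _ _) _; rewrite cardsX cardsC1 cH.
have /subsetPn[v vm] : ~~ ([set v | v \in (alpha :&: Sigma)%VS] \subset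
                       hit :|: [set v | v \in <[w]>%VS]).
  apply/negP => /subset_leq_card; apply/negP; rewrite -ltnNge.
  apply: leq_ltn_trans (leq_card_setU _ _) _.
  rewrite !cardsE !card_vspace dim_Cplane_infty // dim_vline.
  apply: (@leq_ltn_trans (#|F|.-1 * #|F|.-1 + #|F|)).
    apply: leq_add => //; case: (w != 0); rewrite ?expn1 // expn0.
    exact: ltn_trans q_gt2.
  case: #|F| q_gt2 => [|n] // n1; rewrite /= -mulnn mulSn mulnS addnC ltn_add2l.
  by rewrite -[X in (X < _)%N]add0n ltn_add2r -ltnS (ltn_trans _ n1).
rewrite !inE negb_or => /andP[vhit vw]; move: vm; rewrite inE => vm.
exists v; split=> // c c0; apply: contra vhit => Gcv; apply/imsetP.
exists (c^-1, c *: v); last by rewrite /= scalerA mulVf // scale1r.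
rewrite !inE /= invr_eq0 c0 Gcv scaler_eq0 (negPf c0) memvZ; last first.
  by move: vm; rewrite memv_cap => /andP[].
by rewrite /= !andbT; apply: contraNneq vw => ->; rewrite mem0v.
Qed.

Lemma no_three_collinear_cons (W : PG4 F) A : no_three_collinear A ->
  (forall P Q, P \in A -> Q \in A -> P != Q ->
     ~ exists l : PG4 F, is_line l /\ [/\ P <= l, Q <= l & W <= l]%VS) ->
  no_three_collinear (W |` A).
Proof.
move=> A3 WA P Q R; rewrite !in_fset1U.
case/predU1P=> [->|PA]; case/predU1P=> [->|QA]; case/predU1P=> [->|RA];
  rewrite ?eqxx // => PQ PR QR [l [l2 [Pl Ql Rl]]].
- by apply: (WA Q R) => //; exists l.
- by apply: (WA P R) => //; exists l.
- by apply: (WA P Q) => //; exists l.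
- by apply: (A3 P Q R) => //; exists l.
Qed.

Lemma line_span (l : PG4 F) (a b : V) : is_line l -> a \in l -> b \in l ->
  b != 0 -> a \notin <[b]>%VS -> l = <<[:: a; b]>>%VS.
Proof.
move=> l2 al bl b0 ab; apply/esym/eqP; rewrite eqEdim l2 dim_span2 // andbT.
by apply/subvP=> v; apply: mem_span2.
Qed.

(** A combination of [a] and [b] on which [phi] vanishes is a multiple of [a + b], which belongs to
    [G]. *)
Lemma missed_secant w a b (l : PG4 F) : K a -> K b -> a != b ->
  w != 0 -> phi w = 0 -> missed w ->
  is_line l -> a \in l -> b \in l -> w \in l -> False.
Proof.
move=> Ka Kb ab w0 phiw mw l2 al bl.
rewrite (@line_span l a b) // ?affine_neq0 ?phi_Cvec //; last first.
  by apply: contra_neqN ab; apply: affine_vline; apply: phi_Cvec.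
case/span2P=> x [y Ew]; move: phiw; rewrite Ew phiD !phiZ !phi_Cvec // !mulr1.
move/eqP; rewrite addr_eq0 (oppr_pchar2 char2) => /eqP xy.
have y0 : y != 0 by apply: contraNneq w0 => y0; rewrite Ew xy y0 !scale0r addr0.
have /negP[] : ~~ G (y^-1 *: w) by apply: mw; rewrite invr_eq0.
by rewrite Ew xy -scalerDr scalerA mulVf // scale1r Cdir_add_Cvec.
Qed.

(** Adding both points to the q-arc gives a hyperoval: no secant of the arc contains either of them,
    and the line joining them is at infinity, hence has no C-point. *)
Lemma missed_plus alpha w1 w2 : alpha \in Cplanes ->
  w1 \in (alpha :&: Sigma)%VS -> w2 \in (alpha :&: Sigma)%VS ->
  missed w1 -> missed w2 -> w1 != 0 -> w2 \notin <[w1]>%VS ->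
  is_plus_point C Cplanes <[w1]>%VS /\ is_plus_point C Cplanes <[w2]>%VS.
Proof.
rewrite !memv_cap => Ha /andP[a1 S1] /andP[a2 S2] m1 m2 w10 w21.
have w20 : w2 != 0 by apply: contraNneq w21 => ->; rewrite mem0v.
have [spt sq s3] := hA1 Ha.
have notC w : w \in Sigma -> <[w]>%VS \notin C.
  by move=> wS; apply/negP => /hC[_]; rewrite -memvE wS.
have notsect w : w \in Sigma -> <[w]>%VS \notin sect C alpha.
  by move=> /notC; apply: contra; rewrite !inE => /andP[].
have n21 : (<[w2]> != <[w1]>)%VS by apply: contraNneq w21 => <-; rewrite memv_line.
pose Q := <[w2]>%VS |` (<[w1]>%VS |` sect C alpha).
have sectK P : P \in sect C alpha -> exists2 v, K v & P = <[v]>%VS.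
  by rewrite !inE => /andP[/C_Cvec].
have phi1 : phi w1 = 0 by apply/eqP; rewrite -phiP.
have phi2 : phi w2 = 0 by apply/eqP; rewrite -phiP.
have secant w P R : w != 0 -> phi w = 0 -> missed w ->
    P \in sect C alpha -> R \in sect C alpha -> P != R ->
    ~ exists l : PG4 F, is_line l /\ [/\ P <= l, R <= l & <[w]> <= l]%VS.
  move=> w0 pw mw /sectK[a Ka ->] /sectK[b Kb ->] nab [l [l2 []]].
  rewrite -!memvE; apply: missed_secant Ka Kb _ w0 pw mw l2 => //.
  by apply: contra_neq nab => ->.
have tangent P : P \in sect C alpha ->
    ~ exists l : PG4 F, is_line l /\ [/\ P <= l, <[w1]> <= l & <[w2]> <= l]%VS.
  move=> /sectK[a Ka ->] [l [l2 []]]; rewrite -!memvE => al l1 lw2.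
  move: al; rewrite (line_span l2 lw2 l1) // => /(mem_span2 S2 S1).
  by rewrite phiP (phi_Cvec Ka) oner_eq0.
have Qoval : is_hyperoval alpha Q.
  split.
  - move=> P; rewrite !in_fset1U => /or3P[/eqP->|/eqP->|/spt//].
      by rewrite /is_point dim_vline w20 -memvE.
    by rewrite /is_point dim_vline w10 -memvE.
  - rewrite cardfsU1 in_fset1U negb_or n21 notsect // cardfsU1 notsect // sq.
    by rewrite addnA addnC.
  - apply: no_three_collinear_cons; first apply: no_three_collinear_cons => //.
      by move=> P R; apply: secant.
    move=> P R; rewrite !in_fset1U => /predU1P[->|PA] /predU1P[->|RA]; rewrite ?eqxx // => nPR.
    + by move=> [l [l2 [? ? ?]]]; apply: (tangent R RA); exists l.
    + exact: tangent.
    + exact: secant.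
have sQ : sect C alpha `<=` Q by rewrite /Q fsetUA fsubsetUr.
by split; exists alpha, Q; split=> //;
  rewrite in_fsetD notsect // !in_fset1U eqxx ?orbT.
Qed.

(** * The plus-lines, and the C-directions as a graph over [tN] *)

Variables tN tinfty : PG4 F.
Hypothesis tN_line : is_line tN.
Hypothesis tN_Sigma : (tN <= Sigma)%VS.
Hypothesis tinfty_line : is_line tinfty.
Hypothesis tinfty_Sigma : (tinfty <= Sigma)%VS.
Hypothesis tN_tinfty : (tN :&: tinfty)%VS = 0%VS.
Hypothesis hplus : forall P : PG4 F, is_point P ->
  (is_plus_point C Cplanes P <-> (P <= tN)%VS \/ (P <= tinfty)%VS).

Lemma tN_Cdir w : w \in tN -> G w -> w = 0.
Proof.
move=> wt; have [//|w0] := eqVneq w 0; apply: contraTeq => _.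
apply: plus_point_notin_Cdir => //; apply/hplus; first by rewrite /is_point dim_vline w0.
by left; rewrite -memvE.
Qed.

Lemma tinfty_Cdir w : w \in tinfty -> G w -> w = 0.
Proof.
move=> wt; have [//|w0] := eqVneq w 0; apply: contraTeq => _.
apply: plus_point_notin_Cdir => //; apply/hplus; first by rewrite /is_point dim_vline w0.
by right; rewrite -memvE.
Qed.

Lemma tN_tinfty0 v : v \in tN -> v \in tinfty -> v = 0.
Proof.
by move=> vN vi; apply/eqP; rewrite -memv0 -tN_tinfty memv_cap vN vi.
Qed.

Lemma tN_tinfty_indep n i : n \in tN -> n != 0 -> i \in tinfty -> n \notin <[i]>%VS.
Proof.
move=> nN n0 ii; apply: contra_neqN n0 => /vlineP[c E].
by apply: tN_tinfty0 => //; rewrite E memvZ.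
Qed.

Lemma tN_tinfty_decomp x y x' y' : x \in tN -> x' \in tN ->
  y \in tinfty -> y' \in tinfty -> x + y = x' + y' -> x = x' /\ y = y'.
Proof.
move=> xN x'N yi y'i E; have Exx' : x = x'.
  apply/eqP; rewrite -subr_eq0; apply/eqP/tN_tinfty0; first exact: memvB.
  have -> : x - x' = y' - y.
    by apply/eqP; rewrite subr_eq addrAC [y' + _]addrC -E addrK.
  exact: memvB.
by split=> //; move: E; rewrite Exx' => /addrI.
Qed.

Lemma tN_add_tinfty : (tN + tinfty)%VS = Sigma.
Proof.
apply/eqP; rewrite eqEdim subv_add tN_Sigma tinfty_Sigma.
by rewrite dimv_disjoint_sum // tN_line tinfty_line hSigma.
Qed.

(** Two missed points of the plane are plus-points. If both were on the same plus-line, that line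
    would be all of [alpha :&: Sigma], which contains [q] elements of [G], whereas a plus-line
    contains only 0. *)
Lemma Cplane_infty alpha : alpha \in Cplanes ->
  exists n i, [/\ n \in tN, n != 0, i \in tinfty, i != 0 &
                  (alpha :&: Sigma)%VS = <<[:: n; i]>>%VS].
Proof.
(* Avoiding the zero space makes [w1] nonzero; avoiding the span of [w1] then gives a second
   point. *)
move=> Ha; have [w1 [m1 mi1 w10]] := exists_missed 0 Ha.
have [w2 [m2 mi2 w21]] := exists_missed w1 Ha.
have {}w10 : w1 != 0 by apply: contraNneq w10 => ->; rewrite mem0v.
have w20 : w2 != 0 by apply: contraNneq w21 => ->; rewrite mem0v.
have not_both t : is_line t -> (forall w, w \in t -> G w -> w = 0) ->
    w1 \in t -> w2 \in t -> False.
  move=> t2 tG t1 tw2.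
  have Et : t = (alpha :&: Sigma)%VS.
    rewrite (line_span t2 tw2 t1) //; apply/esym/line_span => //.
    exact: dim_Cplane_infty.
  have : (1 < #|[pred g | G g & g \in alpha]|)%N.
    by rewrite card_Cplane_dir // (ltn_trans _ q_gt2).
  case/card_gt1P=> v [w [/andP[Gv va] /andP[Gw wa]]]; case/eqP.
  have G0 u : G u -> u \in alpha -> u = 0.
    by move=> Gu ua; apply: tG => //; rewrite Et memv_cap ua phiP (phi_Cdir Gu) /=.
  by rewrite (G0 v) // (G0 w).
have [p1 p2] := missed_plus Ha m1 m2 mi1 mi2 w10 w21.
have pt (w : V) : w != 0 -> is_point <[w]>%VS by move=> w0; rewrite /is_point dim_vline w0.
have Eline n i : n \in (alpha :&: Sigma)%VS -> i \in (alpha :&: Sigma)%VS ->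
    n \in tN -> n != 0 -> i \in tinfty -> i != 0 ->
    (alpha :&: Sigma)%VS = <<[:: n; i]>>%VS.
  move=> na ia nN n0 ii i0; apply: line_span => //; first exact: dim_Cplane_infty.
  exact: tN_tinfty_indep.
have := (hplus (pt _ w10)).1 p1; have := (hplus (pt _ w20)).1 p2; rewrite -!memvE.
move=> [t2|t2] [t1|t1].
- by case: (not_both tN) => //; apply: tN_Cdir.
- by exists w2, w1; split=> //; apply: Eline.
- by exists w1, w2; split=> //; apply: Eline.
- by case: (not_both tinfty) => //; apply: tinfty_Cdir.
Qed.

(* The C-directions form the graph of a map from [tN] to [tinfty]. *)
Definition gmap (x : V) : V := odflt 0 [pick y | (y \in tinfty) && G (x + y)].
Local Notation g := gmap.

(** Projection to [tN] along [tinfty] is injective on [G], since [G] meets [tinfty] trivially. As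
    [G] and [tN] both have [q ^ 2] elements, it is onto. *)
Lemma gmap_exists x : x \in tN -> exists2 y, y \in tinfty & G (x + y).
Proof.
move=> xN; pose p := daddv_pi tN tinfty.
have dec v : G v -> exists2 y, y \in tinfty & v = p v + y.
  move=> /(phi_Cdir)/eqP; rewrite -phiP -tN_add_tinfty => vS.
  exists (daddv_pi tinfty tN v); first exact: memv_pi.
  by rewrite daddv_pi_add.
have pN v : p v \in tN by exact: memv_pi.
have : x \in p @: G.
  suff /eqP -> : p @: G == [set v | v \in tN] by rewrite inE.
  rewrite eqEcard; apply/andP; split.
    by apply/subsetP => _ /imsetP[v _ ->]; rewrite inE.
  rewrite cardsE card_vspace tN_line card_in_imset ?card_Cdir //.
  move=> v w Gv Gw E; have [y yi Ev] := dec v Gv; have [z zi Ew] := dec w Gw.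
  have Evw : v + w = y + z by rewrite Ev Ew E addrACA addvv add0r.
  have := tinfty_Cdir (memvD yi zi); rewrite -Evw => /(_ (CdirD Gv Gw)) /eqP.
  by rewrite addr_eq0 oppv => /eqP.
case/imsetP=> v Gv ->; have [y yi Ev] := dec v Gv.
by exists y; rewrite // -Ev.
Qed.

Lemma gmapP x : x \in tN -> g x \in tinfty /\ G (x + g x).
Proof.
move=> xN; rewrite /g; case: pickP => [y /andP[] //|nog].
by have [y yi Gy] := gmap_exists xN; have := nog y; rewrite yi Gy.
Qed.

Lemma gmap_infty x : x \in tN -> g x \in tinfty. Proof. by case/gmapP. Qed.

Lemma Cdir_gmap x : x \in tN -> G (x + g x). Proof. by case/gmapP. Qed.

Lemma gmap_uniq x y : x \in tN -> y \in tinfty -> G (x + y) -> y = g x.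
Proof.
move=> xN yi Gxy; have [gi Gg] := gmapP xN; apply/eqP.
rewrite -subr_eq0 oppv; apply/eqP/tinfty_Cdir; first exact: memvD.
by have := CdirD Gxy Gg; rewrite addrACA addvv add0r.
Qed.

Lemma gmapD x y : x \in tN -> y \in tN -> g (x + y) = g x + g y.
Proof.
move=> xN yN; apply/esym/gmap_uniq; rewrite ?memvD ?gmap_infty //.
by rewrite addrACA CdirD ?Cdir_gmap.
Qed.

Lemma gmap_eq0 x : x \in tN -> g x = 0 -> x = 0.
Proof. by move=> xN g0; apply: tN_Cdir => //; have := Cdir_gmap xN; rewrite g0 addr0. Qed.

Lemma gmap0 : g 0 = 0.
Proof. by apply/esym/gmap_uniq; rewrite ?mem0v // addr0 Cdir0. Qed.

Lemma gmap_inj x y : x \in tN -> y \in tN -> g x = g y -> x = y.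
Proof.
move=> xN yN E; apply/eqP; rewrite -subr_eq0 oppv; apply/eqP/gmap_eq0.
  exact: memvD.
by rewrite gmapD // E addvv.
Qed.

Lemma Cdir_decomp v : G v -> exists2 x, x \in tN & v = x + g x.
Proof.
move=> Gv; have /eqP := phi_Cdir Gv; rewrite -phiP -tN_add_tinfty.
case/memv_addP=> x xN [y yi E]; exists x => //.
by rewrite -(gmap_uniq xN yi) -?E.
Qed.

(** The elements of [G] in [alpha] are among the [x + g x] with [x] in the span of [n]. There are
    [q] on either side, so every [c *: n + g (c *: n)] lies in [alpha], and its component in
    [tinfty] is a multiple of [i]. The case [c = 1] allows [g n] to replace [i]. *)
Lemma Cplane_gmap alpha : alpha \in Cplanes ->
  exists n, [/\ n \in tN, n != 0, (alpha :&: Sigma)%VS = <<[:: n; g n]>>%VS &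
                forall c, exists d, g (c *: n) = d *: g n].
Proof.
move=> Ha; have [n [i [nN n0 ii i0 Em]]] := Cplane_infty Ha.
have sub : [set v : V | G v & v \in alpha] \subset (fun x => x + g x) @: [set x | x \in <[n]>%VS].
  apply/subsetP => v; rewrite inE => /andP[Gv va].
  have [x xN Ev] := Cdir_decomp Gv; apply/imsetP; exists x => //; rewrite inE.
  have : v \in (alpha :&: Sigma)%VS by rewrite memv_cap va phiP (phi_Cdir Gv) eqxx.
  rewrite Em Ev => /span2P[c [d]] /tN_tinfty_decomp[||||-> _];
    rewrite ?memvZ ?gmap_infty //.
  exact: memv_line.
have Eimg : [set v : V | G v & v \in alpha] = (fun x => x + g x) @: [set x | x \in <[n]>%VS].
  apply/eqP; rewrite eqEcard sub cardsE card_Cplane_dir //.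
  apply: leq_trans (leq_imset_card _ _) _.
  by rewrite cardsE card_vspace dim_vline n0 expn1.
have gi c : exists d, g (c *: n) = d *: i.
  have cN : c *: n \in tN by rewrite memvZ.
  have : c *: n + g (c *: n) \in [set v : V | G v & v \in alpha].
    by rewrite Eimg; apply/imsetP; exists (c *: n); rewrite // inE memvZ ?memv_line.
  rewrite inE => /andP[Gc ca].
  have : c *: n + g (c *: n) \in (alpha :&: Sigma)%VS by rewrite memv_cap ca phiP (phi_Cdir Gc) eqxx.
  rewrite Em => /span2P[x [d]] /tN_tinfty_decomp[||||_ ->];
    rewrite ?memvZ ?gmap_infty //.
  by exists d.
have [d1 E1] := gi 1; rewrite scale1r in E1.
have d10 : d1 != 0.
  by apply: contraNneq n0 => d0; apply/eqP/gmap_eq0 => //; rewrite E1 d0 scale0r.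
have Ei : i = d1^-1 *: g n by rewrite E1 scalerA mulVf // scale1r.
exists n; split=> // [|c].
  apply: line_span; first exact: dim_Cplane_infty.
  - by rewrite Em memv_span // !inE eqxx.
  - by rewrite Em E1 memvZ // memv_span // !inE eqxx orbT.
  - by rewrite E1 scaler_eq0 negb_or d10.
  - by apply: tN_tinfty_indep => //; apply: gmap_infty.
by have [d ->] := gi c; exists (d / d1); rewrite Ei scalerA.
Qed.

Lemma Cplane_through_gmap x : x \in tN -> x != 0 ->
  exists2 alpha, alpha \in Cplanes & x + g x \in alpha.
Proof.
move=> xN x0; have Gx := Cdir_gmap xN.
have oox : o != o + (x + g x).
  apply: contra_neq x0 => E; apply: tN_tinfty0 => //.
  have /eqP : x + g x = 0 by apply: (addrI o); rewrite addr0 -E.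
  by rewrite addr_eq0 oppv => /eqP ->; apply: gmap_infty.
have [alpha Ha [oa xa]] := Cplane_through Ko Gx oox; exists alpha => //.
by rewrite -(addKv o (x + g x)) memvD.
Qed.

Lemma Cplane_gmap_mem alpha x n : alpha \in Cplanes -> x \in tN ->
  n \in tN -> (alpha :&: Sigma)%VS = <<[:: n; g n]>>%VS ->
  x + g x \in alpha -> exists b d, x = b *: n /\ g x = d *: g n.
Proof.
move=> Ha xN nN Em xa; have : x + g x \in (alpha :&: Sigma)%VS.
  by rewrite memv_cap phiP (phi_Cdir (Cdir_gmap xN)) eqxx andbT.
rewrite Em => /span2P[b [d]] /tN_tinfty_decomp[||||Ex Eg];
  rewrite ?memvZ ?gmap_infty //.
by exists b, d.
Qed.

(** A C-plane containing the direction [x + g x] has [x] as a multiple of its [n]; so [g x] and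
    [g (c *: x)] are both multiples of [g n], the first one nonzero. *)
Lemma gmap_line x c : x \in tN -> exists d, g (c *: x) = d *: g x.
Proof.
move=> xN; have [->|x0] := eqVneq x 0.
  by exists 0; rewrite scaler0 gmap0 scaler0.
have [alpha Ha xa] := Cplane_through_gmap xN x0.
have [n [nN n0 Em gn]] := Cplane_gmap Ha.
have [b [d' [Ex Ed']]] := Cplane_gmap_mem Ha xN nN Em xa.
have [d Ed] := gn (c * b).
have d'0 : d' != 0.
  by apply: contraNneq x0 => d0; apply/eqP/gmap_eq0; rewrite // Ed' d0 scale0r.
by exists (d / d'); rewrite Ed' Ex scalerA Ed scalerA divfK.
Qed.

(** * Semilinearity of [g] and its field automorphism *)

Definition gscale (u : V) (c : F) : F := odflt 0 [pick d | g (c *: u) == d *: g u].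

Lemma gscaleP u c : u \in tN -> g (c *: u) = gscale u c *: g u.
Proof.
move=> uN; rewrite /gscale; case: pickP => [d /eqP //|no].
by have [d Ed] := gmap_line c uN; have := no d; rewrite Ed eqxx.
Qed.

Lemma gscale_inj u : u \in tN -> u != 0 -> injective (gscale u).
Proof.
move=> uN u0 c d E; have : c *: u = d *: u.
  by apply: gmap_inj; rewrite ?memvZ // !gscaleP // E.
move/eqP; rewrite -subr_eq0 -scalerBl scaler_eq0 (negPf u0) orbF subr_eq0.
by move/eqP.
Qed.

(** Being injective on a finite field, [gscale u] is onto, so every multiple of [g u] is the image
    of a multiple of [u]. *)
Lemma gmap_indep u x : u \in tN -> x \in tN -> u != 0 -> x \notin <[u]>%VS ->
  g x \notin <[g u]>%VS.
Proof.
move=> uN xN u0; apply: contra => /vlineP[b Eb].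
have /codomP[c Ec] := injF_onto (gscale_inj uN u0) b.
apply/vlineP; exists c; apply: gmap_inj; rewrite ?memvZ //.
by rewrite gscaleP // Eb Ec.
Qed.

(** Expand [g (c *: (u + x))] by additivity and compare it with a multiple of [g u + g x]: the
    independence of [g u] and [g x] forces equal scalars. *)
Lemma gmap_semilinear_indep u x c : u \in tN -> x \in tN -> u != 0 ->
  x \notin <[u]>%VS -> g (c *: x) = gscale u c *: g x.
Proof.
move=> uN xN u0 xu; have gx := gmap_indep uN xN u0 xu.
have gu0 : g u != 0 by apply: contra_neq u0; apply: gmap_eq0.
have [d Ed] := gmap_line c xN; rewrite Ed; congr (_ *: _).
have [d' Ed'] := gmap_line c (memvD uN xN); move: Ed'.
rewrite scalerDr !gmapD ?memvZ // gscaleP // Ed scalerDr => /eqP.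
rewrite -subr_eq0 opprD addrACA -!scalerBl => /eqP E.
have dd' : d = d'.
  apply/eqP; rewrite -subr_eq0; apply: contraNT gx => d0; apply/vlineP.
  (* This is the relation [E] solved for [g x]. *)
  exists (- (d - d')^-1 * (gscale u c - d')).
  apply: (scalerI d0); rewrite scalerA mulrA mulrN mulfV // mulN1r scaleNr.
  by apply/eqP; rewrite -addr_eq0 addrC E.
move: E; rewrite dd' subrr scale0r addr0 => /eqP.
by rewrite scaler_eq0 (negPf gu0) orbF subr_eq0 => /eqP.
Qed.

(** For [x] in the span of [u], both [x + v] and [v] are outside it; subtract the two instances of
    the independent case. *)
Lemma gmap_semilinear u v x c : u \in tN -> v \in tN -> u != 0 ->
  v \notin <[u]>%VS -> x \in tN -> g (c *: x) = gscale u c *: g x.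
Proof.
move=> uN vN u0 vu xN.
have [xu|xu] := boolP (x \in <[u]>%VS); last exact: gmap_semilinear_indep.
have xvu : x + v \notin <[u]>%VS.
  by apply: contra vu => xv; rewrite -(addKv x v) memvD.
have := gmap_semilinear_indep c uN (memvD xN vN) u0 xvu.
rewrite scalerDr !gmapD ?memvZ // [g (c *: v)](gmap_semilinear_indep c uN vN u0 vu).
by rewrite scalerDr => /addIr.
Qed.

(** Additivity of the scalar comes from that of [g], and multiplicativity from semilinearity at
    [c *: u]. *)
Lemma gscale_Frobenius u v : u \in tN -> v \in tN -> u != 0 ->
  v \notin <[u]>%VS -> exists n, forall c, gscale u c = c ^+ (2 ^ n).
Proof.
move=> uN vN u0 vu; pose a := gscale u.
have gu0 : g u != 0 by apply: contra_neq u0; apply: gmap_eq0.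
have cancel_gu (b c : F) : b *: g u = c *: g u -> b = c.
  move/eqP; rewrite -subr_eq0 -scalerBl scaler_eq0 (negPf gu0) orbF subr_eq0.
  by move/eqP.
have aD : {morph a : b c / b + c}.
  move=> b c; apply: cancel_gu.
  by rewrite -gscaleP // scalerDl gmapD ?memvZ // !gscaleP // -scalerDl.
have oppF (c : F) : - c = c by rewrite (oppr_pchar2 char2).
have aB : {morph a : b c / b - c} by move=> b c; rewrite !oppF aD.
have a1 : a 1 = 1 by apply: cancel_gu; rewrite -gscaleP // !scale1r.
have aM : {morph a : b c / b * c}.
  move=> b c; apply: cancel_gu; rewrite -gscaleP // -[(b * c) *: u]scalerA.
  by rewrite (gmap_semilinear b uN vN u0 vu) ?memvZ // gscaleP // scalerA.
pose a_add := GRing.isZmodMorphism.Build F F a aB.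
pose a_mul := GRing.isMonoidMorphism.Build F F a (conj a1 aM).
pose ra : {rmorphism F -> F} := HB.pack a a_add a_mul.
by have [n En] := finField_char2_endo cardF ra; exists n.
Qed.

(** For a fixed [c], both [u + g u] and its multiple by [c] are in [G], so [c] is 0 or 1 by
    [Cdir_cap]. *)
Lemma gscale_coprime u n : u \in tN -> u != 0 ->
  (forall c, gscale u c = c ^+ (2 ^ n)) -> coprime n h.
Proof.
move=> uN u0 aE; apply: (coprime_of_fixed cardF) => c Ec.
apply: (Cdir_cap (Cdir_gmap uN)).
  apply: contra_neq u0 => /eqP; rewrite addr_eq0 oppv => /eqP E.
  by apply: tN_tinfty0 => //; rewrite E gmap_infty.
by have := Cdir_gmap (memvZ c uN); rewrite gscaleP // aE Ec -scalerDr.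
Qed.

(** * The C-lines in terms of [g] *)

Definition gline x : PG4 F := <<[:: g x; x]>>%VS.

Lemma gline_uniq (l : PG4 F) x : is_line l -> x \in tN -> x != 0 ->
  x \in l -> g x \in l -> l = gline x.
Proof.
move=> l2 xN x0 xl gl; apply: line_span => //.
apply/vlineP=> -[c E]; case/eqP: x0; apply: gmap_eq0 => //.
by apply: tN_tinfty0; rewrite ?gmap_infty // E memvZ.
Qed.

Lemma gline_is_line x : x \in tN -> x != 0 -> is_line (gline x).
Proof.
move=> xN x0; apply: dim_span2 => //.
apply/vlineP=> -[c E]; case/eqP: x0; apply: gmap_eq0 => //.
by apply: tN_tinfty0; rewrite ?gmap_infty // E memvZ.
Qed.

Lemma gline_scale c x : x \in tN -> x != 0 -> c != 0 -> gline (c *: x) = gline x.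
Proof.
move=> xN x0 c0; apply/esym/gline_uniq; first exact: gline_is_line.
- exact: memvZ.
- by rewrite scaler_eq0 negb_or c0.
- by rewrite memvZ // memv_span // !inE eqxx orbT.
have [d ->] := gmap_line c xN.
by rewrite memvZ // memv_span // !inE eqxx.
Qed.

Lemma Cplane_gline alpha : alpha \in Cplanes ->
  exists x, [/\ x \in tN, x != 0 & (alpha :&: Sigma)%VS = gline x].
Proof.
move=> Ha; have [x [xN x0 Em _]] := Cplane_gmap Ha; exists x; split=> //.
by apply: gline_uniq => //; rewrite ?Em ?memv_span ?inE ?eqxx ?orbT // -Em;
  apply: dim_Cplane_infty.
Qed.

Lemma gline_Cplane x : x \in tN -> x != 0 ->
  exists2 alpha, alpha \in Cplanes & (alpha :&: Sigma)%VS = gline x.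
Proof.
move=> xN x0; have [alpha Ha xa] := Cplane_through_gmap xN x0; exists alpha => //.
have [n [nN n0 Em _]] := Cplane_gmap Ha.
have [b [d [Ex Eg]]] := Cplane_gmap_mem Ha xN nN Em xa.
apply: gline_uniq => //; first exact: dim_Cplane_infty.
  by rewrite Em Ex memvZ // memv_span // !inE eqxx.
by rewrite Em Eg memvZ // memv_span // !inE eqxx orbT.
Qed.

(* C-planes with distinct lines at infinity meet in a C-point, because their
   directions generate the group G. *)
Lemma parallel_gline alpha beta x : alpha \in Cplanes -> beta \in Cplanes ->
  x \in tN -> x != 0 -> (alpha :&: Sigma)%VS = gline x ->
  Cparallel C alpha beta -> (beta :&: Sigma)%VS = gline x.
Proof.
move=> Ha Hb xN x0 Ea [<- //|npar].
have [y [yN y0 Eb]] := Cplane_gline Hb; rewrite Eb.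
have [/vlineP[c Ey]|yx] := boolP (y \in <[x]>%VS).
  by rewrite Ey gline_scale //; apply: contraNneq y0 => c0; rewrite Ey c0 scale0r.
case: npar; have [a Ka aa] := Cplane_Cvec Ha; have [b Kb bb] := Cplane_Cvec Hb.
have [z zN Ez] := Cdir_decomp (Cdir_add_Cvec Ka Kb).
have mem gamma w c : (gamma :&: Sigma)%VS = gline w -> w \in tN ->
    c *: w + g (c *: w) \in gamma.
  move=> E wN; have : c *: w + g (c *: w) \in (gamma :&: Sigma)%VS.
    have [d ->] := gmap_line c wN.
    by rewrite E memvD // memvZ // memv_span // !inE eqxx ?orbT.
  by rewrite memv_cap => /andP[].
(* Splitting [a + b] along [y] and [x] moves one summand to each side: [a + f s x = b + f r y] is
   the common C-point. *)
have := zN; rewrite (line_span tN_line yN xN) // => /span2P[r [s Erz]].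
pose f c (w : V) := c *: w + g (c *: w).
have Eab : a + f s x = b + f r y.
  have E : a + b = f r y + f s x by rewrite Ez Erz gmapD ?memvZ // addrACA.
  have -> : a = b + (f r y + f s x) by rewrite -E [a + b]addrC addKv.
  by move: (f r y) (f s x) => u v; rewrite -!addrA addvv addr0.
exists <[a + f s x]>%VS; rewrite -!memvE; split.
- by apply: Cvec_C; apply: Cvec_Cdir => //; apply: Cdir_gmap; rewrite memvZ.
- by rewrite memvD // mem.
- by rewrite Eab memvD // mem.
Qed.

Lemma ClineP l : is_Cline Sigma C Cplanes l <->
  exists x, [/\ x \in tN, x != 0 & l = gline x].
Proof.
split=> [[l2 [alpha Ha Hpar]]|[x [xN x0 ->]]].
  by rewrite -(Hpar alpha) //; [apply: Cplane_gline | left].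
split; first exact: gline_is_line.
have [alpha Ha Ea] := gline_Cplane xN x0; exists alpha => // beta Hb.
exact: parallel_gline.
Qed.

(** * The coordinate system *)

Lemma Cline_coordinates : exists (e : 5.-tuple V) (n : nat),
    [/\ basis_of fullv e,
        forall v : V, v \in Sigma <-> coord e ord_max v = 0
      & coprime n h] /\
    [/\ tN = join2 (vec e 0 0 1 0 0) (vec e 0 0 0 1 0),
        tinfty = join2 (vec e 1 0 0 0 0) (vec e 0 1 0 0 0)
      & forall l : PG4 F, is_Cline Sigma C Cplanes l <->
          (exists t : F, l = m_line e n t) \/ l = m_infty e].
Proof.
pose u := vpick tN; have uN : u \in tN := memv_pick tN.
have u0 : u != 0 by rewrite vpick0 -dimv_eq0 tN_line.
have [v vN vu] : exists2 v, v \in tN & v \notin <[u]>%VS.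
  apply/subvPn/negP => /dimvS; by rewrite tN_line dim_vline u0.
have v0 : v != 0 by apply: contraNneq vu => ->; rewrite mem0v.
have [n aE] := gscale_Frobenius uN vN u0 vu.
have gE c x : x \in tN -> g (c *: x) = c ^+ (2 ^ n) *: g x.
  by move=> xN; rewrite (gmap_semilinear c uN vN u0 vu) // aE.
have tNE : tN = <<[:: v; u]>>%VS by apply: line_span.
have tiE : tinfty = <<[:: g v; g u]>>%VS.
  apply: line_span; rewrite ?gmap_infty ?gmap_indep //.
  by apply: contra_neq u0; apply: gmap_eq0.
(* In this basis [t *: u + v] has coordinates (0, 0, t, 1, 0), and by semilinearity its image under
   [g] has coordinates (t^(2^n), 1, 0, 0, 0). *)
pose e : 5.-tuple V := [tuple g u; g v; u; v; o].
have vecE a0 a1 a2 a3 a4 :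
    vec e a0 a1 a2 a3 a4 = a0 *: g u + (a1 *: g v + (a2 *: u + (a3 *: v + a4 *: o))).
  by rewrite /vec !big_ord_recl big_ord0 /= !(tnth_nth 0) /= addr0.
have phi0 w : w \in Sigma -> phi w = 0 by rewrite phiP => /eqP.
have eB : basis_of fullv e.
  rewrite basisEdim dimvf andbT; apply/subvP => w _.
  have -> : w = (w - phi w *: o) + phi w *: o by rewrite subrK.
  have memE i : i \in (e : seq V) -> i \in <<e>>%VS by apply: memv_span.
  apply: memvD; last by rewrite memvZ // memE // !inE eqxx !orbT.
  have : w - phi w *: o \in (tN + tinfty)%VS.
    by rewrite tN_add_tinfty phiP linearB /= phiZ (phi_Cvec Ko) mulr1 subrr.
  case/memv_addP=> x xN [y yi ->]; apply: memvD.
    by move: xN; rewrite tNE; apply: mem_span2; rewrite memE // !inE eqxx ?orbT.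
  by move: yi; rewrite tiE; apply: mem_span2; rewrite memE // !inE eqxx ?orbT.
(* The form vanishes on the first four basis vectors and is 1 at [o]. *)
have phiE w : phi w = coord e ord_max w.
  rewrite {1}(coord_basis eB (memvf w)) linear_sum /= !big_ord_recr big_ord0 /=.
  rewrite !phiZ (phi_Cvec Ko) mulr1.
  have [uS vS] := (subvP tN_Sigma _ uN, subvP tN_Sigma _ vN).
  have guS := subvP tinfty_Sigma _ (gmap_infty uN).
  have gvS := subvP tinfty_Sigma _ (gmap_infty vN).
  by rewrite !phi0 // !mulr0 !add0r.
exists e, n; split; split=> //.
- by move=> w; rewrite phiP phiE; split=> /eqP.
- exact: gscale_coprime aE.
- rewrite /join2 !vecE !scale0r !scale1r !addr0 !add0r {1}tNE.
  by apply: eq_span => w; rewrite !inE orbC.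
- rewrite /join2 !vecE !scale0r !scale1r !addr0 !add0r {1}tiE.
  by apply: eq_span => w; rewrite !inE orbC.
move=> l.
have mE t : m_line e n t = gline (t *: u + v).
  rewrite /m_line /join2 !vecE !scale0r !scale1r !addr0 !add0r /gline.
  by rewrite gmapD ?memvZ // gE.
have miE : m_infty e = gline u.
  by rewrite /m_infty /join2 !vecE !scale0r !scale1r !addr0 !add0r.
have tuv t : t *: u + v \in tN /\ t *: u + v != 0.
  split; first by rewrite memvD ?memvZ.
  apply: contraNneq vu => /eqP; rewrite addr_eq0 oppv => /eqP E.
  by rewrite -E memvZ ?memv_line.
split=> [/ClineP[x [xN x0 ->]]|El]; last first.
  apply/ClineP; case: El => [[t ->]|->]; last by exists u.
  by have [? ?] := tuv t; exists (t *: u + v).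
move: xN; rewrite {1}tNE => /span2P[s [r Ex]].
(* A C-line depends only on the point spanned by [x = s *: v + r *: u]: it is [m_infty] when
   [s = 0], and otherwise scaling [s] to 1 gives the parameter [t = s^-1 * r]. *)
have [s0|s0] := eqVneq s 0.
  right; rewrite miE Ex s0 scale0r add0r gline_scale //.
  by apply: contraNneq x0 => r0; rewrite Ex s0 r0 !scale0r addr0.
left; exists (s^-1 * r); have [txN tx0] := tuv (s^-1 * r).
rewrite mE -(gline_scale txN tx0 s0) scalerDr !scalerA mulrA mulfV // mul1r.
by rewrite Ex addrC.
Qed.

End Directions.
End CArc.

Local Open Scope fset_scope.

Theorem theorem4p11 (h : nat) (F : finFieldType)
    (cardF : #|F| = (2 ^ h)%N) (q_gt2 : (2 < #|F|)%N)
    (Sigma : PG4 F) (hSigma : is_hyperplane Sigma)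
    (C Cplanes : {fset {vspace 'rV[F]_5}})
    (hC : forall P : PG4 F, P \in C -> is_affine_point Sigma P)
    (cardC : #|` C | = (#|F| ^ 2)%N)
    (hCplanes : forall alpha : PG4 F, alpha \in Cplanes -> is_plane alpha)
    (hA1 : condA1 C Cplanes) (hA2 : condA2 C Cplanes)
    (hA3 : condA3 Sigma C Cplanes) (hA4 : condA4 C Cplanes)
    (tN tinfty : PG4 F)
    (htN : is_line tN /\ (tN <= Sigma)%VS)
    (htinfty : is_line tinfty /\ (tinfty <= Sigma)%VS)
    (hdisj : (tN :&: tinfty)%VS = 0%VS)
    (hplus : forall P : PG4 F, is_point P ->
       (is_plus_point C Cplanes P <-> (P <= tN)%VS \/ (P <= tinfty)%VS)) :
  exists (e : 5.-tuple 'rV[F]_5) (n : nat),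
    [/\ basis_of fullv e,
        forall v : 'rV[F]_5, v \in Sigma <-> coord e ord_max v = 0
      & coprime n h] /\
    [/\ tN = join2 (vec e 0 0 1 0 0) (vec e 0 0 0 1 0),
        tinfty = join2 (vec e 1 0 0 0 0) (vec e 0 1 0 0 0)
      & forall l : PG4 F, is_Cline Sigma C Cplanes l <->
          (exists t : F, l = m_line e n t) \/ l = m_infty e].
Proof.
have /fset0Pn[P PC] : C != fset0.
  by rewrite -cardfs_gt0 cardC expn_gt0 (ltn_trans _ q_gt2).
(* One C-point provides both a vector off [Sigma], from which the form is built, and the base point
   [o]. *)
have [P1 PSigma] := hC _ PC.
have [p pP pSigma] := subvPn PSigma.
have dimS : (\dim Sigma).+1 = \dim {:'rV[F]_5} by rewrite hSigma dimvf.
have [phi phiP] := hyperplane_form pSigma dimS.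
have [o Ko _] := C_Cvec phiP hC PC.
have [[tN2 tNS] [ti2 tiS]] := (htN, htinfty).
exact: (Cline_coordinates cardF q_gt2 hSigma phiP hC cardC hCplanes hA1 hA2 hA3 hA4
  Ko tN2 tNS ti2 tiS hdisj hplus).
Qed.
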